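(* Let $\varphi(x):=1+\frac43\,\frac{x^2}{(1+x^2)^2}$ for $x\geq 0$. Then $$\int_0^\infty\frac{1}{(1+x^2)^{\frac32}\sqrt{\varphi(x)+\sqrt{\varphi(x)^3}}}\,dx=\frac{\pi}{2\sqrt6}.$$ *)

(* Defs.v *)
From Stdlib Require Import Reals.
Open Scope R_scope.

Definition phi (x : R) : R := 1 + 4 / 3 * (x ^ 2 / (1 + x ^ 2) ^ 2).

(* Main.v *)
Require Import Defs.
From Stdlib Require Import Reals Lra.
From Coquelicot Require Import Coquelicot.
Open Scope R_scope.

(** Write psi for the square root of phi.  The substitution x = tan t turns the
    integral into the integral of cos t * F(t) over [0, PI/2], where
    F = 1 / (psi * sqrt (1 + psi)) and psi = sqrt (1 + m^2 / 3) depends on t only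
    through m = 2 sin t cos t ([is_RInt_gen_comp_atan] and
    [integrand_eq_kernel_atan]).

    On its own, cos t * F(t) is not expected to have an elementary primitive.
    But F is invariant under t |-> PI/2 - t, so cos t may be replaced by the mean
    of cos t and sin t ([RInt_cos_mult_symmetric]).  Now cos t + sin t is the
    derivative of v = sin t - cos t, and m = 1 - v^2, so what remains is half of
    the integral over v in [-1, 1] of F seen as a function of v, and that one is
    elementary.

    To find its primitive for v > 0, parametrize m / sqrt 3 = sinh a, so that
    psi = cosh a, and put u = tanh (a/2).  Up to sign, F dv becomes
    sqrt (3/2) du / sqrt (4 - (u + sqrt 3)^2), whose primitive is a multiple of
    asin ((u + sqrt 3) / 2).  The point v = 0 is a branch point of this arcsine;
    passing to the complementary angle and writing it as an arctangent gives
    [kernel_primitive], which is odd and smooth in v ([is_derive_kernel_primitive]).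
    At v = 1 and v = -1 the arctangent is PI/6 and -PI/6, whence
    (1/2) * (sqrt 6 / 2) * (PI/3) = PI / (2 sqrt 6). *)

(** * The substitution x = tan t *)

Lemma is_lim_atan_p_infty :
  filterlim atan (Rbar_locally p_infty) (locally (PI / 2)).
Proof.
apply (filterlim_ext_loc (fun x => PI / 2 - atan (/ x))).
{ exists 0; intros x Hx; rewrite atan_inv by exact Hx; ring. }
assert (Hc : continuous (fun y => PI / 2 - atan y) 0).
{ apply (continuous_minus (V := R_NormedModule) (fun _ => PI / 2) atan 0).
  - apply continuous_const.
  - apply continuous_atan. }
unfold continuous in Hc; rewrite atan_0, Rminus_0_r in Hc.
refine (filterlim_comp _ _ _ Rinv _ _ _ _ _ Hc).
exact (filterlim_Rbar_inv p_infty ltac:(discriminate)).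
Qed.

Lemma is_derive_RInt_continuous (f : R -> R) (a t : R) :
  (forall s, continuous f s) -> is_derive (fun s => RInt f a s) t (f t).
Proof.
intros Hf; apply (is_derive_RInt f (fun s => RInt f a s) a); [|apply Hf].
apply filter_forall; intros s; apply (RInt_correct f).
apply (ex_RInt_continuous f); intros; apply Hf.
Qed.

(** The primitive K of f, composed with atan, is a primitive of the left-hand
    integrand; K is continuous at PI/2, so the improper integral converges to the
    increment of K over [0, PI/2]. *)
Lemma is_RInt_gen_comp_atan (f : R -> R) :
  (forall t, continuous f t) ->
  is_RInt_gen (fun x => f (atan x) / (1 + x ^ 2))
    (at_point 0) (Rbar_locally p_infty) (RInt f 0 (PI / 2)).
Proof.
intros Hf.
pose (K := fun t => RInt f 0 t).
assert (HK : forall x, is_derive (fun y => K (atan y)) x (f (atan x) / (1 + x ^ 2))).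
{ intros x.
  evar_last.
  - apply (is_derive_comp K atan x); [|apply is_derive_atan].
    apply is_derive_RInt_continuous, Hf.
  - unfold scal; simpl; unfold mult; simpl; unfold Rsqr; field; nra. }
assert (E : K (PI / 2) - K (atan 0) = RInt f 0 (PI / 2)).
{ unfold K; rewrite atan_0, RInt_point; unfold zero; simpl; ring. }
rewrite <- E.
apply (is_RInt_gen_ext (Derive (fun y => K (atan y)))).
{ apply filter_forall; intros ab x _; apply is_derive_unique, HK. }
apply is_RInt_gen_Derive.
- apply filter_forall; intros ab x _; eexists; apply HK.
- apply filter_forall; intros ab x _.
  apply (continuous_ext (fun x => f (atan x) / (1 + x ^ 2))).
  { intros y; symmetry; apply is_derive_unique, HK. }
  apply (continuous_mult (fun x => f (atan x)) (fun x => / (1 + x ^ 2))).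
  + apply continuous_comp; [apply continuous_atan | apply Hf].
  + apply (ex_derive_continuous (fun x => / (1 + x ^ 2))); auto_derive; nra.
- intros P HP; exact (locally_singleton _ _ HP).
- apply (filterlim_comp _ _ _ atan K _ _ _ is_lim_atan_p_infty).
  apply (ex_derive_continuous K); eexists.
  apply is_derive_RInt_continuous, Hf.
Qed.

(** * Symmetrization *)

(** The reflection t |-> PI/2 - t exchanges cos and sin and preserves f, so the
    integrals of cos * f and sin * f agree. *)
Lemma RInt_cos_mult_symmetric (f : R -> R) :
  (forall t, continuous f t) -> (forall t, f (PI / 2 - t) = f t) ->
  RInt (fun t => cos t * f t) 0 (PI / 2) =
  / 2 * RInt (fun t => (cos t + sin t) * f t) 0 (PI / 2).
Proof.
intros Hf Hsym.
assert (Hc : forall t, continuous (fun t => cos t * f t) t).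
{ intros t; apply (continuous_mult cos f); [apply continuous_cos | apply Hf]. }
assert (Hs : forall t, continuous (fun t => sin t * f t) t).
{ intros t; apply (continuous_mult sin f); [apply continuous_sin | apply Hf]. }
assert (Ic : forall a b, ex_RInt (fun t => cos t * f t) a b)
  by (intros; apply (ex_RInt_continuous (fun t => cos t * f t)); auto).
assert (Is : forall a b, ex_RInt (fun t => sin t * f t) a b)
  by (intros; apply (ex_RInt_continuous (fun t => sin t * f t)); auto).
assert (Hcs : RInt (fun t => sin t * f t) 0 (PI / 2) =
              RInt (fun t => cos t * f t) 0 (PI / 2)).
{ pose proof (RInt_comp_lin (fun t => cos t * f t) (-1) (PI / 2) 0 (PI / 2)
    (Ic _ _)) as H.
  replace (-1 * 0 + PI / 2) with (PI / 2) in H by ring.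
  replace (-1 * (PI / 2) + PI / 2) with 0 in H by field.
  rewrite <- (opp_RInt_swap (fun t => cos t * f t)) in H by apply Ic.
  rewrite (RInt_ext _ (fun t => opp (sin t * f t))) in H.
  - rewrite (RInt_opp (fun t => sin t * f t)) in H by apply Is.
    unfold opp in H; simpl in H; lra.
  - intros t _; unfold scal, opp; simpl; unfold mult; simpl.
    replace (-1 * t + PI / 2) with (PI / 2 - t) by ring.
    rewrite Hsym, cos_shift; ring. }
rewrite (RInt_ext (fun t => (cos t + sin t) * f t)
  (fun t => plus (cos t * f t) (sin t * f t)))
  by (intros; unfold plus; simpl; ring).
rewrite (RInt_plus (fun t => cos t * f t) (fun t => sin t * f t))
  by auto.
rewrite Hcs; unfold plus; simpl; lra.
Qed.

(** * The primitive of the symmetrized integrand *)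

(** The square root of phi (tan t), for m = 2 sin t cos t = sin (2t). *)
Definition root_phi (m : R) : R := sqrt (1 + m ^ 2 / 3).

(** Equal to 1 / sqrt (phi + sqrt (phi ^ 3)) for phi = root_phi m ^ 2. *)
Definition kernel (m : R) : R := / (root_phi m * sqrt (1 + root_phi m)).

Lemma root_phi_gt_0 (m : R) : 0 < root_phi m.
Proof. apply sqrt_lt_R0; nra. Qed.

Lemma root_phi_sqr (m : R) : root_phi m ^ 2 = 1 + m ^ 2 / 3.
Proof. apply pow2_sqrt; nra. Qed.

Lemma continuous_kernel (m : R) : continuous kernel m.
Proof.
pose proof (root_phi_gt_0 m) as Hr.
apply (ex_derive_continuous kernel); unfold kernel, root_phi in *; auto_derive.
replace (m * (m * 1)) with (m ^ 2) by ring.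
unfold Rdiv in *; set (r := sqrt _) in *.
repeat split; try nra.
apply Rgt_not_eq, Rmult_lt_0_compat; [exact Hr | apply sqrt_lt_R0; lra].
Qed.

(** This is sqrt (3/2) * acos ((u + sqrt 3) / 2) for 0 <= v <= 1, where
    u = m / (sqrt 3 * (1 + psi)), m = 1 - v^2 and psi = root_phi m.  The arctangent
    form extends it smoothly and oddly through the branch point v = 0. *)
Definition kernel_primitive (v : R) : R :=
  sqrt 6 / 2 *
  atan (sqrt 6 * v * sqrt (1 + root_phi (1 - v ^ 2)) /
        (1 - v ^ 2 + 3 * (1 + root_phi (1 - v ^ 2)))).

Lemma is_derive_root_phi (m : R) : is_derive root_phi m (m / (3 * root_phi m)).
Proof.
pose proof (root_phi_gt_0 m) as Hr; unfold root_phi in *; auto_derive; [nra|].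
replace (m * (m * 1)) with (m ^ 2) by ring.
unfold Rdiv in *; set (r := sqrt _) in *; field; lra.
Qed.

(** The only danger is v^2 > 1, where 3 * root_phi m >= sqrt 3 * |m| dominates m. *)
Lemma denominator_gt_0 (v : R) :
  0 < 1 - v ^ 2 + 3 * (1 + root_phi (1 - v ^ 2)).
Proof.
pose proof (root_phi_gt_0 (1 - v ^ 2)); pose proof (root_phi_sqr (1 - v ^ 2)).
nra.
Qed.

(** With N / D the argument of the arctangent, the square roots disappear from
    the derivative through root_phi m ^ 2 = 1 + m^2 / 3: D^2 + N^2
    collapses to 12 (1 + psi)^2, and N' D - N D', up to the
    factor sqrt 6 / (psi * sqrt (1 + psi)), to 4 (1 + psi)^2. *)
Lemma is_derive_kernel_primitive (v : R) :
  is_derive kernel_primitive v (kernel (1 - v ^ 2)).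
Proof.
unfold kernel_primitive, kernel.
pose proof (root_phi_gt_0 (1 - v ^ 2)) as Hr.
pose proof (root_phi_sqr (1 - v ^ 2)) as Hr2.
pose proof (denominator_gt_0 v) as HD.
auto_derive.
- change (1 + - (v * (v * 1))) with (1 + - (v ^ 2)).
  change (1 + - v ^ 2) with (1 - v ^ 2).
  repeat split; try lra; eexists; apply is_derive_root_phi.
- change (1 + - (v * (v * 1))) with (1 - v ^ 2).
  replace (Derive (fun x => root_phi x) (1 - v ^ 2))
    with ((1 - v ^ 2) / (3 * root_phi (1 - v ^ 2)))
    by (symmetry; apply is_derive_unique, is_derive_root_phi).
  set (r := root_phi (1 - v ^ 2)) in *.
  assert (Hq : 0 < sqrt (1 + r)) by (apply sqrt_lt_R0; lra).
  assert (Hq2 : sqrt (1 + r) ^ 2 = 1 + r) by (apply pow2_sqrt; lra).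
  assert (Hs : sqrt 6 ^ 2 = 6) by (apply pow2_sqrt; lra).
  set (q := sqrt (1 + r)) in *; set (s := sqrt 6) in *.
  remember (1 - v ^ 2 + 3 * (1 + r)) as D eqn:ED.
  remember (1 - v ^ 2) as m eqn:Em.
  assert (Hden : D ^ 2 + 6 * v ^ 2 * q ^ 2 = 12 * (1 + r) ^ 2).
  { rewrite Hq2, ED; replace (v ^ 2) with (1 - m) by lra.
    transitivity (12 * (1 + r) ^ 2 + (m ^ 2 - 3 * (r ^ 2 - 1)));
      [ring | rewrite Hr2; field]. }
  assert (Hnum : ((q ^ 2 * r - v ^ 2 * m / 3) * D
                  + v ^ 2 * q ^ 2 * (2 * r + 2 * m)) = 4 * (1 + r) ^ 2).
  { rewrite Hq2, ED; replace (v ^ 2) with (1 - m) by lra.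
    (* The cofactor 3 r - m + 4 is the quotient of the difference of the two
       sides by the relation between r and m. *)
    transitivity (4 * (1 + r) ^ 2 + (3 * r - m + 4) * (r ^ 2 - (1 + m ^ 2 / 3)));
      [field | rewrite Hr2; ring]. }
  transitivity (s ^ 2 / 2 *
    ((q ^ 2 * r - v ^ 2 * m / 3) * D + v ^ 2 * q ^ 2 * (2 * r + 2 * m)) /
    ((D ^ 2 + s ^ 2 * v ^ 2 * q ^ 2) * (r * q))).
  + field; pose proof (pow2_ge_0 (s * v * q)); repeat split; nra.
  + rewrite Hs, Hden, Hnum; field; repeat split; nra.
Qed.

(** Here cos t + sin t is the derivative of v = sin t - cos t, and
    2 sin t cos t = 1 - v^2, so kernel_primitive (sin t - cos t) is a primitive;
    v runs from -1 to 1. *)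
Lemma is_RInt_kernel_trig :
  is_RInt (fun t => (cos t + sin t) * kernel (2 * (sin t * cos t)))
    0 (PI / 2) (PI / sqrt 6).
Proof.
assert (Hd : forall t, is_derive (fun t => kernel_primitive (sin t - cos t)) t
  ((cos t + sin t) * kernel (2 * (sin t * cos t)))).
{ intros t.
  replace (2 * (sin t * cos t)) with (1 - (sin t - cos t) ^ 2)
    by (pose proof (sin2_cos2 t) as H; unfold Rsqr in H; lra).
  apply (is_derive_comp kernel_primitive (fun t => sin t - cos t));
    [apply is_derive_kernel_primitive | auto_derive; [exact I | ring]]. }
replace (PI / sqrt 6) with
  (minus (kernel_primitive (sin (PI / 2) - cos (PI / 2)))
         (kernel_primitive (sin 0 - cos 0))).
- apply (is_RInt_derive (fun t => kernel_primitive (sin t - cos t))).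
  + intros; apply Hd.
  + intros t _.
    apply (continuous_mult (fun t => cos t + sin t)
                           (fun t => kernel (2 * (sin t * cos t)))).
    * apply (ex_derive_continuous (fun t => cos t + sin t)); auto_derive; exact I.
    * apply (continuous_comp (fun t => 2 * (sin t * cos t)) kernel);
        [|apply continuous_kernel].
      apply (ex_derive_continuous (fun t => 2 * (sin t * cos t))).
      auto_derive; exact I.
- rewrite sin_PI2, cos_PI2, sin_0, cos_0; unfold kernel_primitive.
  replace (1 - 0) with 1 by ring; replace (0 - 1) with (-1) by ring.
  replace (1 - 1 ^ 2) with 0 by ring; replace (1 - (-1) ^ 2) with 0 by ring.
  replace (root_phi 0) with 1
    by (unfold root_phi; rewrite <- sqrt_1 at 1; f_equal; field).
  replace (1 + 1) with 2 by ring.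
  assert (H6 : sqrt 6 = sqrt 2 * sqrt 3)
    by (rewrite <- sqrt_mult by lra; f_equal; ring).
  assert (H2 : sqrt 2 ^ 2 = 2) by (apply pow2_sqrt; lra).
  assert (H3 : sqrt 3 ^ 2 = 3) by (apply pow2_sqrt; lra).
  assert (P2 : 0 < sqrt 2) by (apply sqrt_lt_R0; lra).
  assert (P3 : 0 < sqrt 3) by (apply sqrt_lt_R0; lra).
  assert (Hat : atan (1 / sqrt 3) = PI / 6).
  { rewrite <- tan_PI6; apply atan_tan; pose proof PI_RGT_0; lra. }
  assert (Harg : sqrt 6 * sqrt 2 / 6 = 1 / sqrt 3).
  { replace (sqrt 6 * sqrt 2) with (2 * sqrt 3) by (rewrite H6; nra).
    replace 6 with (2 * sqrt 3 ^ 2) by lra; field; lra. }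
  replace (sqrt 6 * 1 * sqrt 2 / (0 + 3 * 2)) with (1 / sqrt 3)
    by (rewrite <- Harg; field).
  replace (sqrt 6 * -1 * sqrt 2 / (0 + 3 * 2)) with (- (1 / sqrt 3))
    by (rewrite <- Harg; field).
  rewrite atan_opp, Hat; unfold minus, plus, opp; simpl.
  assert (Hs : sqrt 6 ^ 2 = 6) by (apply pow2_sqrt; lra).
  assert (P6 : 0 < sqrt 6) by (apply sqrt_lt_R0; lra).
  apply (Rmult_eq_reg_r (6 * sqrt 6)); [|lra].
  field_simplify; [|lra]. rewrite Hs; lra.
Qed.

(** * The value of the integral *)

(** At t = atan x the factor cos t / (1 + x^2) is (1 + x^2)^(-3/2), and
    sin t cos t = x / (1 + x^2) identifies phi x with root_phi (2 sin t cos t) ^ 2. *)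
Lemma integrand_eq_kernel_atan (x : R) :
  cos (atan x) * kernel (2 * (sin (atan x) * cos (atan x))) / (1 + x ^ 2) =
  1 / (Rpower (1 + x ^ 2) (3 / 2) * sqrt (phi x + sqrt (phi x ^ 3))).
Proof.
assert (Hx : 0 < 1 + x ^ 2) by nra.
rewrite sin_atan, cos_atan; unfold kernel.
replace (1 + x²) with (1 + x ^ 2) by (unfold Rsqr; ring).
assert (Hp : 0 < sqrt (1 + x ^ 2)) by (apply sqrt_lt_R0, Hx).
assert (Hp2 : sqrt (1 + x ^ 2) ^ 2 = 1 + x ^ 2) by (apply pow2_sqrt; lra).
assert (Hpow : Rpower (1 + x ^ 2) (3 / 2) = (1 + x ^ 2) * sqrt (1 + x ^ 2)).
{ replace (3 / 2) with (1 + / 2) by field.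
  rewrite Rpower_plus, Rpower_1, Rpower_sqrt by exact Hx; reflexivity. }
rewrite Hpow.
set (p := sqrt (1 + x ^ 2)) in *.
set (m := 2 * (x / p * (1 / p))).
pose proof (root_phi_gt_0 m) as Hr.
assert (Hphi : phi x = root_phi m ^ 2).
{ rewrite root_phi_sqr; unfold phi, m; rewrite <- Hp2; field; lra. }
rewrite Hphi; set (r := root_phi m) in *.
replace (sqrt ((r ^ 2) ^ 3)) with (r ^ 3)
  by (replace ((r ^ 2) ^ 3) with ((r ^ 3) ^ 2) by ring;
      rewrite sqrt_pow2; [reflexivity | apply pow_le; lra]).
replace (r ^ 2 + r ^ 3) with (r ^ 2 * (1 + r)) by ring.
rewrite sqrt_mult, sqrt_pow2 by nra.
assert (0 < sqrt (1 + r)) by (apply sqrt_lt_R0; lra).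
field; repeat split; lra.
Qed.

Theorem proposition4 :
  is_RInt_gen
    (fun x : R =>
       1 / (Rpower (1 + x ^ 2) (3 / 2) * sqrt (phi x + sqrt (phi x ^ 3))))
    (at_point 0) (Rbar_locally p_infty)
    (PI / (2 * sqrt 6)).
Proof.
set (f := fun t => kernel (2 * (sin t * cos t))).
assert (Hf : forall t, continuous f t).
{ intros t; apply (continuous_comp (fun t => 2 * (sin t * cos t)) kernel);
    [|apply continuous_kernel].
  apply (ex_derive_continuous (fun t => 2 * (sin t * cos t))).
  auto_derive; exact I. }
assert (Hsym : forall t, f (PI / 2 - t) = f t).
{ intros t; unfold f; rewrite sin_shift, cos_shift; f_equal; ring. }
replace (PI / (2 * sqrt 6)) with (RInt (fun t => cos t * f t) 0 (PI / 2)).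
- apply (is_RInt_gen_ext
    (fun x => (fun t => cos t * f t) (atan x) / (1 + x ^ 2))).
  { apply filter_forall; intros ab x _; apply integrand_eq_kernel_atan. }
  apply (is_RInt_gen_comp_atan (fun t => cos t * f t)).
  intros t; apply (continuous_mult cos f); [apply continuous_cos | apply Hf].
- rewrite RInt_cos_mult_symmetric by assumption.
  assert (Hint : RInt (fun t => (cos t + sin t) * f t) 0 (PI / 2) = PI / sqrt 6)
    by exact (is_RInt_unique _ _ _ _ is_RInt_kernel_trig).
  rewrite Hint.
  change (/ 2 * (PI / sqrt 6) = PI / (2 * sqrt 6)).
  field; apply Rgt_not_eq, sqrt_lt_R0; lra.
Qed.
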